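(* Let $A_1,A_2\in\mathbb{R}^{n\times n}$ and $B_1,B_2\in\mathbb{R}^{n\times m}$. If $F(x,u)=(H(x,u),G(x,u))$ is a topological equivalence transformation from the system $\dot x(t)=A_1x(t)+B_1u(t)$ to the system $\dot y(t)=A_2y(t)+B_2v(t)$, then $H(x,u)$ is independent of $u$, so that it can be written as $H(x)$. Furthermore, $H(x)$ is a homeomorphism from $\mathbb{R}^n$ to $\mathbb{R}^n$.
   Context: For real matrices $A$ ($n\times n$) and $B$ ($n\times m$), $(A,B)$ denotes the linear controlled system $\dot x(t)=Ax(t)+Bu(t)$, $t\ge 0$, with state $x(t)\in\mathbb{R}^n$ and control $u(t)\in\mathbb{R}^m$. Let $F(x,u)=(H(x,u),G(x,u))$ with $H\in C(\mathbb{R}^n\times\mathbb{R}^m;\mathbb{R}^n)$ and $G\in C(\mathbb{R}^n\times\mathbb{R}^m;\mathbb{R}^m)$. One says that $F$ brings $(A_1,B_1)$ to $(A_2,B_2)$ if for every $x^0\in\mathbb{R}^n$ and every $u\in C([0,+\infty);\mathbb{R}^m)$, whenever $x(t)$ is the solution of $(A_1,B_1)$ with $x(0)=x^0$ and control $u$, then $y(t)=H(x(t),u(t))$ is the solution of $(A_2,B_2)$ with initial datum $y(0)=H(x^0,u(0))$ and control $v(t)=G(x(t),u(t))$. $F$ is a topological equivalence transformation from $(A_1,B_1)$ to $(A_2,B_2)$ if $F$ is a homeomorphism of $\mathbb{R}^n\times\mathbb{R}^m$ onto itself, with inverse $F^{-1}(y,v)=(Z(y,v),W(y,v))$, such that $F$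 brings $(A_1,B_1)$ to $(A_2,B_2)$ and $F^{-1}$ brings $(A_2,B_2)$ to $(A_1,B_1)$ (in the same sense, with $(Z,W)$ in place of $(H,G)$ and the roles of the systems exchanged). *)

(* Defs.v *)
From HB Require Import structures.
From mathcomp Require Export all_boot all_order all_algebra.
From mathcomp Require Export all_classical all_reals all_analysis.
Export Order.TTheory GRing.Theory Num.Theory.
Export numFieldNormedType.Exports.

Set Implicit Arguments.
Unset Strict Implicit.
Unset Printing Implicit Defensive.

Local Open Scope classical_set_scope.
Local Open Scope ring_scope.

Definition inverse_homeomorphisms (S T : topologicalType)
    (f : S -> T) (g : T -> S) : Prop :=
  [/\ continuous f, continuous g, cancel f g & cancel g f].

Definition homeomorphism (S T : topologicalType) (f : S -> T) : Prop :=
  exists g : T -> S, inverse_homeomorphisms f g.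

(* Functions on [0, +oo[ are encoded as functions on R whose values at
   negative times are never used: the derivative below is two-sided for t > 0
   and is the right derivative at t = 0. *)
Definition has_derivative_ge0 (R : realType) (n : nat)
    (x : R -> 'cV[R]_n) (t : R) (v : 'cV[R]_n) : Prop :=
  h^-1 *: (x (t + h) - x t) @[h --> within [set h : R | 0 <= t + h] 0^'] --> v.

Definition is_solution (R : realType) (n m : nat)
    (A : 'M[R]_n) (B : 'M[R]_(n, m)) (x0 : 'cV[R]_n) (u : R -> 'cV[R]_m)
    (x : R -> 'cV[R]_n) : Prop :=
  x 0 = x0 /\
  forall t : R, 0 <= t -> has_derivative_ge0 x t (A *m x t + B *m u t).

Definition brings (R : realType) (n m : nat)
    (A1 : 'M[R]_n) (B1 : 'M[R]_(n, m)) (A2 : 'M[R]_n) (B2 : 'M[R]_(n, m))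
    (H : 'cV[R]_n * 'cV[R]_m -> 'cV[R]_n)
    (G : 'cV[R]_n * 'cV[R]_m -> 'cV[R]_m) : Prop :=
  forall (x0 : 'cV[R]_n) (u : R -> 'cV[R]_m) (x : R -> 'cV[R]_n),
    {within `[0, +oo[, continuous u} ->
    is_solution A1 B1 x0 u x ->
    is_solution A2 B2 (H (x0, u 0)) (fun t => G (x t, u t))
      (fun t => H (x t, u t)).

Definition topological_equivalence (R : realType) (n m : nat)
    (A1 : 'M[R]_n) (B1 : 'M[R]_(n, m)) (A2 : 'M[R]_n) (B2 : 'M[R]_(n, m))
    (H : 'cV[R]_n * 'cV[R]_m -> 'cV[R]_n)
    (G : 'cV[R]_n * 'cV[R]_m -> 'cV[R]_m) : Prop :=
  exists (Z : 'cV[R]_n * 'cV[R]_m -> 'cV[R]_n)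
         (W : 'cV[R]_n * 'cV[R]_m -> 'cV[R]_m),
    [/\ inverse_homeomorphisms (fun p => (H p, G p)) (fun q => (Z q, W q)),
        brings A1 B1 A2 B2 H G
      & brings A2 B2 A1 B1 Z W].

(* Main.v *)
Require Import Defs.

(** Why [H] cannot depend on the control.  Fix a state [x0] and two controls
    [u0], [u0 + w].  For small [e > 0], steer the first system from [x0] with
    the control running affinely from [u0] to [u0 + w] during the time [e].
    The state hardly moves, since the slope [w / e] of the control is
    compensated by the length [e] of the interval (lemma
    [fast_control_transfer]).  The image [t |-> H (x t, u t)] is a trajectory
    of the second system, whose velocity [A2 *m H + B2 *m G] stays bounded
    along the motion, because the pairs (state, control) remain near the
    compact segment [{x0} * [u0, u0 + w]] (lemma [near_segment_bounded]).
    Hence the image moves by [O(e)] in time [e], while its endpoints are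
    [H (x0, u0)] and [H (x_e, u0 + w)] with [x_e --> x0].  Letting [e] tend to
    [0] gives [H (x0, u0) = H (x0, u0 + w)].

    The same argument applied to the inverse transformation shows that [Z] does
    not depend on [v] either.  Then [H (., 0)] and [Z (., 0)] are continuous,
    and they are inverse to each other: [Z (H (x, 0), 0)] equals
    [Z (H (x, 0), G (x, 0)) = x].

    The trajectories used above have to exist.  They solve a linear equation
    with affine forcing, and are obtained entrywise as exponential generating
    functions of the sequence of their derivatives at [0] (lemma
    [affine_forced_ode]). *)

Set Implicit Arguments.
Unset Strict Implicit.
Unset Printing Implicit Defensive.
Local Open Scope classical_set_scope.
Local Open Scope ring_scope.

(** * Linear equations with affine forcing *)

(** The exponential generating function of [c]; unlike the ordinary one, it
    converges on all of [R] as soon as [c] grows at most geometrically. *)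
Definition egf (R : realType) (c : nat -> R) (t : R) : R :=
  limn (pseries (fun k => c k / k`!%:R) t).

Lemma is_cvg_egf (R : realType) (c : nat -> R) (C K t : R) :
  (forall k, `|c k| <= C * K ^+ k) ->
  cvgn (pseries (fun k => c k / k`!%:R) t).
Proof.
move=> cCK; apply: normed_cvg.
apply: (@series_le_cvg _ _ (C *: exp_coeff (K * `|t|))) => [k|k|k|].
- by rewrite /=.
- rewrite fctE /exp_coeff /= /GRing.scale /= exprMn mulrA mulrA.
  by rewrite divr_ge0// mulr_ge0// (le_trans _ (cCK k)).
- rewrite fctE /exp_coeff /= /GRing.scale /= exprMn !normrM normrX.
  rewrite normfV normr_nat mulrAC !mulrA ler_wpM2r ?invr_ge0//.
  by rewrite ler_wpM2r.
- exact/is_cvg_seriesZ/is_cvg_series_exp_coeff.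
Qed.

(** This is what turns a linear recurrence on the sequence into a linear
    differential equation for its generating function. *)
Lemma is_derive_egf (R : realType) (c : nat -> R) (C K t : R) :
  (forall k, `|c k| <= C * K ^+ k) ->
  is_derive t 1 (egf c) (egf (fun k => c k.+1) t).
Proof.
move=> cCK.
have shift (d : nat -> R) :
    pseries_diffs (fun k => d k / k`!%:R) = (fun k => d k.+1 / k`!%:R).
  apply/funext => k; rewrite /pseries_diffs factS natrM invfM.
  by rewrite mulrCA mulVKf.
have c1CK k : `|c k.+1| <= (C * K) * K ^+ k by rewrite -mulrA -exprS.
have c2CK k : `|c k.+2| <= (C * K * K) * K ^+ k.
  by rewrite -!mulrA -!exprS.
rewrite /egf -shift.
apply: (@pseries_snd_diffs _ _ (`|t| + 1)); rewrite ?shift.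
- exact: is_cvg_egf cCK.
- exact: is_cvg_egf c1CK.
- exact: is_cvg_egf c2CK.
- by rewrite [ltRHS]ger0_norm ?ltrDl// addr_ge0.
Qed.

Lemma ler_mx_norm_entry (R : realType) (m n : nat) (M : 'M[R]_(m, n)) i j :
  `|M i j| <= `|M|.
Proof.
rewrite [leRHS]/Num.norm /= mx_normrE.
exact: (le_bigmax _ (fun ij => `|M ij.1 ij.2|) (i, j)).
Qed.

(** The derivatives at [0] of a solution satisfy [a 0 = x0] and
    [a k.+1 = A *m a k + b k], where [b] lists the derivatives at [0] of the
    forcing term, that is [f0, f1, 0, 0, ...].  This sequence grows at most
    geometrically, so its exponential generating function is defined on all of
    [R]; the recurrence makes it a solution. *)
Lemma affine_forced_ode (R : realType) (n : nat) (A : 'M[R]_n)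
    (x0 f0 f1 : 'cV[R]_n) :
  exists x : R -> 'cV[R]_n, x 0 = x0 /\
    forall t : R, is_derive t 1 x (A *m x t + (f0 + t *: f1)).
Proof.
pose b k : 'cV[R]_n := if k is 0 then f0 else if k is 1 then f1 else 0.
pose a := fix a k := if k is k'.+1 then A *m a k' + b k' else x0.
pose C := `|x0| + `|f0| + `|f1|.
(* The summand 1 absorbs the contribution of [b k] in the induction below. *)
pose K := 1 + \sum_i \sum_j `|A i j|.
have K1 : 1 <= K by rewrite lerDl; do 2![apply: sumr_ge0 => ? _].
have bC i k : `|b k i 0| <= C.
  case: k => [|[|k]]; rewrite /C /b.
  - by rewrite (le_trans (ler_mx_norm_entry _ _ _))// -addrA addrCA lerDl addr_ge0.
  - by rewrite (le_trans (ler_mx_norm_entry _ _ _))// lerDr addr_ge0.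
  - by rewrite mxE normr0 !addr_ge0.
have aCK i k : `|a k i 0| <= C * K ^+ k.
  elim: k i => [|k IH] i.
    rewrite expr0 mulr1 /= (le_trans (ler_mx_norm_entry _ _ _))//.
    by rewrite /C -addrA lerDl addr_ge0.
  have CK0 : 0 <= C * K ^+ k by exact: le_trans (IH i).
  rewrite /= mxE (le_trans (ler_normD _ _))//.
  rewrite exprS mulrCA {1}/K mulrDl mul1r [leRHS]addrC.
  apply: lerD; last first.
    rewrite (le_trans (bC i k))// ler_peMr ?exprn_ege1//.
    by rewrite !addr_ge0.
  rewrite mxE (le_trans (ler_norm_sum _ _ _))//.
  apply: le_trans (ler_wpM2r CK0 (_ : \sum_j `|A i j| <= _)); last first.
    by rewrite [leRHS](bigD1 i)//= lerDl; do 2![apply: sumr_ge0 => ? _].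
  by rewrite mulr_suml ler_sum// => j _; rewrite normrM ler_wpM2l.
pose x t : 'cV[R]_n := \col_i egf (fun k => a k i 0) t.
have dx (t : R) i :
    is_derive t (1 : R) (fun s => x s i 0) ((A *m x t + (f0 + t *: f1)) i 0).
  rewrite (_ : (fun s => x s i 0) = egf (fun k => a k i 0)); last first.
    by apply/funext => s; rewrite mxE.
  rewrite (_ : (_ + _ : 'cV[R]_n) i 0 = egf (fun k => a k.+1 i 0) t).
    exact: is_derive_egf (aCK i).
  apply/esym/cvg_lim => //.
  have -> : pseries (fun k => a k.+1 i 0 / k`!%:R) t =
      (fun N => \sum_j A i j * pseries (fun k => a k j 0 / k`!%:R) t N +
       pseries (fun k => b k i 0 / k`!%:R) t N).
    apply/funext => N; rewrite /pseries /series /=.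
    under [X in _ = X + _]eq_bigr do rewrite mulr_sumr.
    rewrite exchange_big -big_split /=; apply: eq_bigr => k _.
    rewrite mxE mulrDl mulrDl; congr (_ + _).
    by rewrite mxE !mulr_suml; apply: eq_bigr => j _; rewrite !mulrA.
  rewrite mxE; apply: cvgD.
    rewrite mxE; apply: cvg_big => [|j _]; first exact: add_continuous.
    apply: cvgM; first exact: cvg_cst.
    by rewrite mxE; exact: is_cvg_egf (aCK j).
  (* The series of [b] stops after its first two terms, [f0] and [t *: f1]. *)
  apply: cvg_near_cst; exists 2 => // N /= N2.
  rewrite /pseries /series /= -(subnKC N2) big_mkord.
  rewrite (big_ord_recl _) (big_ord_recl _) big1 => [|k _].
    by rewrite /= !mxE expr0 expr1 fact0 invr1 !mulr1 addr0 (mulrC _ t).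
  by rewrite /= mxE !mul0r.
exists x; split.
  apply/colP => i; rewrite mxE; apply/cvg_lim => //.
  apply: cvg_near_cst; exists 1 => // N /= N1.
  rewrite /pseries /series /= -(subnKC N1) big_mkord big_ord_recl big1 => [|k _].
    by rewrite expr0 fact0 invr1 !mulr1 addr0.
  by rewrite expr0n /= mulr0.
move=> t; have dM : derivable x t 1.
  by apply/derivable_mxP => i j; rewrite (ord1 j); case: (dx t i).
split=> //; rewrite derive_mx//; apply/colP => i; rewrite mxE.
by case: (dx t i).
Qed.

(** * One-sided and two-sided derivatives *)

Lemma is_derive_quotientP (R : realType) (V : normedModType R)
    (f : R -> V) (t : R) (v : V) :
  is_derive t (1 : R) f v <->
  h^-1 *: (f (t + h) - f t) @[h --> (0 : R)^'] --> v.
Proof.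
have qE : (fun h => h^-1 *: (f (t + h) - f t)) =
          (fun h => h^-1 *: ((f \o shift t) (h *: (1 : R)) - f t)).
  by apply/funext => h /=; rewrite [h *: _]mulr1 (addrC h).
rewrite qE; split=> [[df <-]//|fv].
split; first by apply/cvg_ex; exists v.
exact: cvg_lim fv.
Qed.

Lemma is_derive_has_derivative_ge0 (R : realType) (n : nat)
    (x : R -> 'cV[R]_n) (t : R) (v : 'cV[R]_n) :
  is_derive t (1 : R) x v -> has_derivative_ge0 x t v.
Proof. by move=> /is_derive_quotientP ?; exact: cvg_within_filter. Qed.

Lemma has_derivative_ge0_is_derive (R : realType) (n : nat)
    (x : R -> 'cV[R]_n) (t : R) (v : 'cV[R]_n) :
  0 < t -> has_derivative_ge0 x t v -> is_derive t (1 : R) x v.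
Proof.
move=> t0 xv; apply/is_derive_quotientP => U /xv; rewrite /within /= => nU.
suff tge0 : \forall h \near (0 : R)^', 0 <= t + h.
  exact: filterS2 (fun h Uh th => Uh th) nU tge0.
near=> h; rewrite -[h]opprK subr_ge0 ltW// (le_lt_trans (ler_norm _))// normrN.
by near: h; exact: dnbhs0_lt.
Unshelve. all: by end_near. Qed.

Lemma is_derive_entry (R : realType) (m n : nat) (x : R -> 'M[R]_(m, n))
    (t : R) (v : 'M[R]_(m, n)) i j :
  is_derive t (1 : R) x v -> is_derive t (1 : R) (fun s => x s i j) (v i j).
Proof.
move=> [dx xv]; split; first exact: (iffLR (derivable_mxP _ _ _) dx).
by rewrite -xv derive_mx// mxE.
Qed.

Lemma is_derive_continuous (R : realType) (V : normedModType R)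
    (f df : R -> V) :
  (forall t : R, is_derive t (1 : R) f (df t)) -> continuous f.
Proof.
move=> fdf t; apply: differentiable_continuous.
by apply/derivable1_diffP; case: (fdf t).
Qed.

Lemma continuous_mulmx_entry (R : realType) (T : topologicalType) (m n p : nat)
    (A : 'M[R]_(m, n)) (f : T -> 'M[R]_(n, p)) i j :
  continuous f -> continuous (fun t => (A *m f t) i j).
Proof.
move=> cf; rewrite (_ : (fun t => _) = fun t => \sum_k A i k * f t k j).
  move=> t; apply: cvg_big => [|k _]; first exact: add_continuous.
  apply: cvgM; first exact: cvg_cst.
  exact: continuous_comp (cf t) (@coord_continuous _ _ _ k j _).
by apply/funext => t; rewrite mxE.
Qed.

(** * Fast changes of the control *)

(** The summand [e^-1 *: psi (e * s)] is [s] times the difference quotient of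
    [psi] at [0], taken at [e * s], hence tends to [0].  The limit is joint in
    [(s, e)] with [s] varying near a fixed time, as the compactness argument
    on [s] requires. *)
Lemma cvg_fast_motion (R : realType) (V : normedModType R) (phi psi : R -> V) (s : R) :
  {for 0, continuous phi} -> psi 0 = 0 -> is_derive 0 (1 : R) psi 0 ->
  phi (p.2 * p.1) + p.2^-1 *: psi (p.2 * p.1)
    @[p --> filter_prod (nbhs s) (0 : R)^'+] --> phi 0.
Proof.
move=> cphi psi0 /is_derive_quotientP dpsi.
pose rho t := t^-1 *: psi t.
have crho : {for (0 : R), continuous rho}.
  apply/continuous_withinNx; rewrite {2}/rho psi0 scaler0.
  by move: dpsi; under eq_fun do rewrite psi0 subr0 add0r.
have cst : p.2 * p.1 @[p --> filter_prod (nbhs s) (0 : R)^'+] --> (0 : R).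
  rewrite -[X in _ --> X](mul0r s); apply: cvgM; last exact: cvg_fst.
  apply: cvg_trans cvg_snd _; exact: cvg_within.
rewrite -[X in _ --> X]addr0; apply: cvgD.
  exact: cvg_comp cst cphi.
have : p.1 *: rho (p.2 * p.1)
    @[p --> filter_prod (nbhs s) (0 : R)^'+] --> s *: rho 0.
  by apply: cvgZ; [exact: cvg_fst|apply: cvg_comp cst _; exact: crho].
rewrite {2}/rho psi0 !scaler0; apply: cvg_trans; apply: near_eq_cvg.
have psnd : p.2 @[p --> filter_prod (nbhs s) (0 : R)^'+] --> (0 : R)^'+.
  exact: cvg_snd.
near=> p; rewrite /rho.
have p20 : p.2 != 0.
  rewrite gt_eqF//; near: p; exact: psnd (nbhs_right_gt 0).
have [->|p10] := eqVneq p.1 0; first by rewrite mulr0 psi0 !scaler0.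
by rewrite scalerA invfM mulrCA mulfV// mulr1.
Unshelve. all: by end_near. Qed.

(** By linearity the solution is [phi + e^-1 *: psi], where [phi] starts at
    [x0] under the constant control [u0] and [psi] starts at [0] under the
    control [t *: w].  The time is rescaled as [t = e * s], so that the control
    at rescaled time [s] is [u0 + s *: w] for every [e]. *)
Lemma fast_control_transfer (R : realType) (n m : nat)
    (A : 'M[R]_n) (B : 'M[R]_(n, m)) (x0 : 'cV[R]_n) (u0 w : 'cV[R]_m) :
  exists x : R -> R -> 'cV[R]_n,
    [/\ forall e, x e 0 = x0,
        forall e (t : R), is_derive t (1 : R) (x e)
          (A *m x e t + B *m (u0 + (e^-1 * t) *: w))
      & forall s : R, x p.2 (p.2 * p.1)
          @[p --> filter_prod (nbhs s) (0 : R)^'+] --> x0].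
Proof.
have [phi [phi0 dphi]] := affine_forced_ode A x0 (B *m u0) 0.
have [psi [psi0 dpsi]] := affine_forced_ode A 0 0 (B *m w).
exists (fun e t => phi t + e^-1 *: psi t); split=> [e|e t|s].
- by rewrite psi0 scaler0 addr0.
- set d := (X in is_derive _ _ _ X).
  have -> : d = (A *m phi t + (B *m u0 + t *: 0)) +
      e^-1 *: (A *m psi t + (0 + t *: (B *m w))).
    rewrite /d scaler0 addr0 add0r !mulmxDr -!scalemxAr scalerDr scalerA.
    by rewrite addrACA.
  exact: is_deriveD (dphi t) (is_deriveZ _ (dpsi t)).
- rewrite -phi0; apply: (@cvg_fast_motion R _ phi psi) => //.
    exact: is_derive_continuous dphi 0.
  by have := dpsi 0; rewrite psi0 mulmx0 scale0r !addr0.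
Qed.

(** Local convergence gives a local bound around each [s]; compactness of
    [[0, 1]] makes it uniform.  The bound [C] is itself taken along the filter
    at infinity, so that one use of the covering property handles both [C] and
    the neighborhoods in [F]. *)
Lemma near_segment_bounded (R : realType) (T : Type) (F : set_system T)
    (f : R * T -> R) (l : R -> R) :
  ProperFilter F ->
  (forall s, f p @[p --> filter_prod (nbhs s) F] --> l s) ->
  exists C, \forall e \near F, forall s, s \in `[0, 1] -> `|f (s, e)| <= C.
Proof.
move=> PF fl; pose CF : set_system (R * T) := filter_prod (pinfty_nbhs R) F.
have FCF : Filter CF by exact: filter_prod_filter.
have /compact_near_coveringP := @segment_compact R 0 1.
case/(_ _ CF (fun Ce s => `|f (s, Ce.2)| <= Ce.1) FCF).
  move=> s _.
  have : `|f p| @[p --> filter_prod (nbhs s) F] --> `|l s|.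
    by apply: cvg_norm; exact: fl.
  move=> /cvgr_lt /(_ (`|l s| + 1)); rewrite ltrDl.
  move=> /(_ ltr01) [[S E] /= [sS FE] SE].
  exists (S, [set Ce | `|l s| + 1 <= Ce.1 /\ E Ce.2]) => /=.
    split=> //; exists ([set C | `|l s| + 1 <= C], E) => //=.
    by split=> //; apply: nbhs_pinfty_ge; exact: num_real.
  move=> [s' [C e]] /= [Ss' [lC Ee]]; rewrite (le_trans _ lC)// ltW//.
  exact: (SE (s', e)).
move=> [P Q] [/= Poo FQ] PQ; have [C PC] := filter_ex Poo; exists C.
by apply: filterS FQ => e Qe s s01; apply: (PQ (C, e)).
Qed.

(** * Transformations that bring one system to another *)

(** The mean value theorem bounds the displacement of each coordinate of
    [H (x e t, u e t)] on [[0, e]] by [C * e]; both sides then pass to the limit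
    [e --> 0]. *)
Lemma brings_state_indep (R : realType) (n m : nat)
    (A1 A2 : 'M[R]_n) (B1 B2 : 'M[R]_(n, m))
    (H : 'cV[R]_n * 'cV[R]_m -> 'cV[R]_n)
    (G : 'cV[R]_n * 'cV[R]_m -> 'cV[R]_m) :
  continuous H -> continuous G -> brings A1 B1 A2 B2 H G ->
  forall x0 u0 u1, H (x0, u0) = H (x0, u1).
Proof.
move=> cH cG HG x0 u0 u1.
have [w wE] : exists w, u1 = u0 + w by exists (u1 - u0); rewrite addrC subrK.
have [x [x_0 dx xs0]] := fast_control_transfer A1 B1 x0 u0 w.
pose u (e t : R) := u0 + (e^-1 * t) *: w.
have cu e : continuous (u e).
  move=> t; apply: cvgD; first exact: cvg_cst.
  apply: cvgZ; last exact: cvg_cst.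
  exact: mulrl_continuous.
have cxu e : continuous (fun t => (x e t, u e t)).
  move=> t; apply: (@cvg_pair _ _ _ _ (nbhs (x e t)) (nbhs (u e t))).
    exact: is_derive_continuous (dx e) t.
  exact: cu.
have u_0 e : u e 0 = u0 by rewrite /u mulr0 scale0r addr0.
pose Phi p := A2 *m H p + B2 *m G p.
(* At [t = 0] the image has only a right derivative; the mean value theorem
   asks for two-sided derivatives in the open interval alone. *)
have dy e (t : R) : 0 < t ->
    is_derive t (1 : R) (fun r => H (x e r, u e r)) (Phi (x e t, u e t)).
  move=> t0; apply: has_derivative_ge0_is_derive => //.
  have [] := HG x0 (u e) (x e).
  - exact: continuous_subspaceT.
  - by split=> // r r0; exact/is_derive_has_derivative_ge0.
  - by move=> _ /(_ t (ltW t0)).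
apply/colP => i.
have cPhi : continuous (fun p => Phi p i 0).
  rewrite (_ : (fun p => _) =
      fun p => (A2 *m H p) i 0 + (B2 *m G p) i 0); last first.
    by apply/funext => p; rewrite mxE.
  by move=> p; apply: cvgD; exact: continuous_mulmx_entry.
have [C Cb] : exists C, \forall e \near (0 : R)^'+, forall s, s \in `[0, 1] ->
    `|Phi (x e (e * s), u0 + s *: w) i 0| <= C.
  apply: (near_segment_bounded
    (f := fun p => Phi (x p.2 (p.2 * p.1), u0 + p.1 *: w) i 0)
    (l := fun s => Phi (x0, u0 + s *: w) i 0)) => s.
  apply: (cvg_comp (fun p => (x p.2 (p.2 * p.1), u0 + p.1 *: w))
    (fun q => Phi q i 0) _ (cPhi (x0, u0 + s *: w))).
  apply: (@cvg_pair _ _ _ _ (nbhs x0) (nbhs (u0 + s *: w))); first exact: xs0.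
  apply: cvgD; first exact: cvg_cst.
  by apply: cvgZ; [exact: cvg_fst|exact: cvg_cst].
have small : \forall e \near (0 : R)^'+,
    `|H (x e (e * 1), u1) i 0 - H (x0, u0) i 0| <= C * e.
  near=> e.
  have e0 : 0 < e by near: e; exact: nbhs_right_gt.
  have Cbe : forall s, s \in `[0, 1] ->
      `|Phi (x e (e * s), u0 + s *: w) i 0| <= C by near: e.
  pose y t := H (x e t, u e t) i 0.
  have cy : continuous y.
    move=> t; apply: (@continuous_comp _ _ _ (fun t => H (x e t, u e t))
      (fun v : 'cV[R]_n => v i 0)); last exact: coord_continuous.
    exact: continuous_comp (cxu e t) (cH _).
  have [t|c ce yE] := @MVT _ y (fun t => Phi (x e t, u e t) i 0) 0 e e0 _
      (continuous_subspaceT cy).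
    by rewrite in_itv => /= /andP[t0 _]; apply: is_derive_entry; exact: dy.
  move: yE; rewrite /y x_0 u_0 mulr1 /u mulVf ?gt_eqF// scale1r.
  rewrite -wE => ->; rewrite subr0 normrM (gtr0_norm e0).
  rewrite ler_wpM2r ?(ltW e0)//.
  (* The intermediate time [c] is [e * s] with [s := e^-1 * c] in [[0, 1]]. *)
  have cE : c = e * (e^-1 * c) by rewrite mulVKf ?gt_eqF.
  rewrite {1}cE; apply: Cbe.
  move: ce; rewrite !in_itv /= => /andP[c0 ce].
  by rewrite mulr_ge0 ?invr_ge0 ?(ltW c0) ?(ltW e0)//= ler_pdivrMl// mulr1 ltW.
have lim1 : `|H (x e (e * 1), u1) i 0 - H (x0, u0) i 0| @[e --> (0 : R)^'+] -->
    `|H (x0, u1) i 0 - H (x0, u0) i 0|.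
  apply: cvg_norm; apply: cvgB; last exact: cvg_cst.
  apply: (cvg_comp (fun e => H (x e (e * 1), u1)) (fun y => y i 0) _
    (@coord_continuous _ _ _ i 0 _)).
  apply: (cvg_comp (fun e => (x e (e * 1), u1)) H _ (cH (x0, u1))).
  apply: (@cvg_pair _ _ _ _ (nbhs x0) (nbhs u1)); last exact: cvg_cst.
  apply: (cvg_comp (fun e => (1, e)) (fun p => x p.2 (p.2 * p.1)) _ (xs0 1)).
  apply: (@cvg_pair _ _ _ _ (nbhs (1 : R)) ((0 : R)^'+)); last exact: cvg_id.
  exact: cvg_cst.
have lim2 : C * e @[e --> (0 : R)^'+] --> C * 0.
  by apply: cvgM; [exact: cvg_cst|exact: cvg_within].
have : `|H (x0, u1) i 0 - H (x0, u0) i 0| <= C * 0.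
  exact: (@ler_cvg_to _ _ _ _ _ _ _ _ lim1 lim2 small).
by rewrite mulr0 normr_le0 subr_eq0 => /eqP ->.
Unshelve. all: by end_near. Qed.

Theorem proposition1p1 (R : realType) (n m : nat)
    (A1 A2 : 'M[R]_n) (B1 B2 : 'M[R]_(n, m))
    (H : 'cV[R]_n * 'cV[R]_m -> 'cV[R]_n)
    (G : 'cV[R]_n * 'cV[R]_m -> 'cV[R]_m)
    (HG : topological_equivalence A1 B1 A2 B2 H G) :
  exists h : 'cV[R]_n -> 'cV[R]_n,
    (forall (x : 'cV[R]_n) (u : 'cV[R]_m), H (x, u) = h x) /\
    homeomorphism h.
Proof.
have [Z [W [[cF cF' FK F'K] bF bF']]] := HG.
have cfst (f : 'cV[R]_n * 'cV[R]_m -> 'cV[R]_n * 'cV[R]_m) :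
    continuous f -> continuous (fst \o f).
  by move=> cf p; exact: continuous_comp (cf p) cvg_fst.
have csnd (f : 'cV[R]_n * 'cV[R]_m -> 'cV[R]_n * 'cV[R]_m) :
    continuous f -> continuous (snd \o f).
  by move=> cf p; exact: continuous_comp (cf p) cvg_snd.
have Hu x u u' : H (x, u) = H (x, u').
  exact: (brings_state_indep (cfst _ cF) (csnd _ cF) bF).
have Zv y v v' : Z (y, v) = Z (y, v').
  exact: (brings_state_indep (cfst _ cF') (csnd _ cF') bF').
have c0 (f : 'cV[R]_n * 'cV[R]_m -> 'cV[R]_n) :
    continuous f -> continuous (fun x => f (x, 0)).
  move=> cf x; apply: (cvg_comp (fun y => (y, 0)) f _ (cf (x, 0))).
  apply: (@cvg_pair _ _ _ _ (nbhs x) (nbhs (0 : 'cV[R]_m)) (nbhs_filter x)); first exact: cvg_id.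
  exact: cvg_cst.
exists (fun x => H (x, 0)); split; first by move=> x u; exact: Hu.
exists (fun y => Z (y, 0)); split.
- exact: c0 (cfst _ cF).
- exact: c0 (cfst _ cF').
- by move=> x; rewrite (Zv _ _ (G (x, 0))); have [] := FK (x, 0).
- by move=> y; rewrite (Hu _ _ (W (y, 0))); have [] := F'K (y, 0).
Qed.
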